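(* Let $c>0$ and let $\alpha\in\mathcal{K}$ be continuous on $[0,c]$ and $C^2$ on $(0,c)$. If $r_\alpha(\epsilon,c)<1$ for some $0<\epsilon<c$, then there exists a nontrivial interval $\mathcal{I}_{\mathrm{cave}}\subset(0,c)$ on which $\alpha$ is strictly concave.
   Context: A function $\alpha:[0,a)\to[0,\infty)$ (with $0<a\le\infty$) is of class $\mathcal{K}$ if it is continuous, strictly increasing on $[0,a)$ and $\alpha(0)=0$; here the domain contains $[0,c]$. For $\alpha\in\mathcal{K}$ and $0<\epsilon<c$, the crossing time is $T_\alpha(\epsilon,c)=\int_\epsilon^c \frac{1}{\alpha(y)}\,dy$, the windowed nominal rate is $\sigma_\alpha(\epsilon,c)=\frac{\ln(c/\epsilon)}{T_\alpha(\epsilon,c)}$, and the endpoint-relaxation ratio is $r_\alpha(\epsilon,c)=\frac{\alpha(c)}{\sigma_\alpha(\epsilon,c)\,c}$. *)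

(* Defs.v *)
From Stdlib Require Import Reals.
From Coquelicot Require Import Coquelicot.
Open Scope R_scope.

(* A function [0,a) -> [0,oo) is represented by a total function R -> R, all
   of whose properties are relativized to [dom_K a]. *)
Definition dom_K (a : Rbar) (x : R) : Prop :=
  0 <= x /\ Rbar_lt (Finite x) a.

Definition class_K (a : Rbar) (alpha : R -> R) : Prop :=
  Rbar_lt (Finite 0) a /\
  (forall x, dom_K a x -> 0 <= alpha x) /\
  continuous_on (dom_K a) alpha /\
  (forall x y, dom_K a x -> dom_K a y -> x < y -> alpha x < alpha y) /\
  alpha 0 = 0.

(* [ex_derive_n f k] only speaks about the last derivative and [Derive_n] is
   total, hence the quantification over every order [k <= n]; only meant for
   open [D]. *)
Definition C_n_on (n : nat) (D : R -> Prop) (f : R -> R) : Prop :=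
  forall k x, (k <= n)%nat -> D x ->
    ex_derive_n f k x /\ continuous (Derive_n f k) x.

Definition crossing_time (alpha : R -> R) (eps c : R) : R :=
  RInt (fun y => 1 / alpha y) eps c.

Definition nominal_rate (alpha : R -> R) (eps c : R) : R :=
  ln (c / eps) / crossing_time alpha eps c.

Definition relaxation_ratio (alpha : R -> R) (eps c : R) : R :=
  alpha c / (nominal_rate alpha eps c * c).

Definition is_interval (I : R -> Prop) : Prop :=
  forall x y z, I x -> I y -> x <= z <= y -> I z.

Definition nontrivial_interval (I : R -> Prop) : Prop :=
  is_interval I /\ exists x y, I x /\ I y /\ x < y.

Definition strictly_concave_on (I : R -> Prop) (f : R -> R) : Prop :=
  forall x y t, I x -> I y -> x <> y -> 0 < t < 1 ->
    t * f x + (1 - t) * f y < f (t * x + (1 - t) * y).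

(* Main.v *)
Require Import Defs.
From Stdlib Require Import Reals.
From Coquelicot Require Import Coquelicot.
From Stdlib Require Import Lra Classical.
Open Scope R_scope.

(** A chord-versus-graph argument.  If the graph of [alpha] stayed below its
    chord from the origin to [(c, alpha c)], then [1 / alpha y] would dominate
    [(c / alpha c) * (1 / y)] on [(eps, c)]; integrating, the crossing time would
    be at least [(c / alpha c) * ln (c / eps)], which says exactly that the
    relaxation ratio is at least 1 ([relaxation_ratio_ge1]).

    So a ratio below 1 yields a point [y] strictly above the chord.  The average
    slope of [alpha] from 0 to [y] then exceeds the one from [y] to [c],
    and two uses of the mean value theorem make [alpha'] decrease between two
    points; a third produces a point where [alpha''] is negative
    ([above_chord_negative_Derive2]).  By continuity [alpha''] is negative near
    that point, and [alpha] is strictly concave there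
    ([strictly_concave_on_Derive2_neg]). *)

(** * The mean value theorem under one-sided continuity at the endpoints *)

Definition clamp (a b x : R) : R := Rmax a (Rmin x b).

Lemma clamp_id (a b x : R) : a <= x <= b -> clamp a b x = x.
Proof.
  intros Hx; unfold clamp.
  rewrite Rmin_left by lra; apply Rmax_right; lra.
Qed.

Lemma clamp_bounds (a b x : R) : a <= b -> a <= clamp a b x <= b.
Proof.
  intros Hab; unfold clamp; split; [apply Rmax_l|].
  apply Rmax_lub; [exact Hab | apply Rmin_r].
Qed.

Lemma clamp_dist (a b x y : R) :
  Rabs (clamp a b y - clamp a b x) <= Rabs (y - x).
Proof.
  unfold clamp, Rmax, Rmin.
  repeat destruct Rle_dec; unfold Rabs; repeat destruct Rcase_abs; lra.
Qed.

(** Precomposing with [clamp] turns continuity relative to [[a, b]] into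
    continuity on the whole line without changing the function on [[a, b]];
    this makes theorems that ask for two-sided continuity at the endpoints
    applicable. *)
Lemma continuous_clamp (f : R -> R) (a b x : R) :
  a <= b -> continuous_on (fun z => a <= z <= b) f ->
  continuous (fun z => f (clamp a b z)) x.
Proof.
  intros Hab Hf.
  refine (filterlim_comp _ _ _ (clamp a b) f _
            (within (fun z => a <= z <= b) (locally (clamp a b x))) _ _ _).
  - intros P [d Hd]; exists d; intros z Hz.
    apply Hd; [|now apply clamp_bounds].
    eapply Rle_lt_trans; [apply clamp_dist | exact Hz].
  - exact (Hf _ (clamp_bounds a b x Hab)).
Qed.

Lemma mean_value_continuous_on (f : R -> R) (a b : R) :
  a < b -> continuous_on (fun z => a <= z <= b) f ->
  (forall z, a < z < b -> ex_derive f z) ->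
  exists u, a < u < b /\ f b - f a = Derive f u * (b - a).
Proof.
  intros Hab Hc Hd.
  set (g := fun z => f (clamp a b z)).
  assert (Hg : forall z, a < z < b -> is_derive g z (Derive f z)).
  { intros z Hz; apply (is_derive_ext_loc f); [|now apply Derive_correct, Hd].
    apply (locally_interval _ z a b); [apply Hz | apply Hz|].
    simpl; intros y Hay Hyb; unfold g; rewrite clamp_id by lra; reflexivity. }
  assert (pr1 : forall z, a < z < b -> derivable_pt g z).
  { intros z Hz; exists (Derive f z); now apply is_derive_Reals, Hg. }
  destruct (MVT g id a b pr1 (fun z _ => derivable_pt_id z) Hab)
    as [u [Hu Heq]].
  - intros z _; apply continuity_pt_filterlim, continuous_clamp; [lra | exact Hc].
  - intros z _; apply derivable_continuous_pt, derivable_pt_id.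
  - exists u; split; [exact Hu|].
    rewrite derive_pt_id in Heq.
    rewrite (derive_pt_eq_0 g u (Derive f u)) in Heq
      by now apply is_derive_Reals, Hg.
    unfold g, id in Heq; rewrite !clamp_id in Heq by lra; lra.
Qed.

Lemma ex_derive_continuous_on (f : R -> R) (D : R -> Prop) :
  (forall z, D z -> ex_derive f z) -> continuous_on D f.
Proof.
  intros Hd; apply continuous_on_forall; intros z Hz.
  now apply (ex_derive_continuous f), Hd.
Qed.

(** * Strict concavity from a negative second derivative *)

Lemma strictly_concave_on_ordered (I : R -> Prop) (f : R -> R) :
  (forall x y t, I x -> I y -> x < y -> 0 < t < 1 ->
    t * f x + (1 - t) * f y < f (t * x + (1 - t) * y)) ->
  strictly_concave_on I f.
Proof.
  intros H x y t Hx Hy Hxy Ht.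
  destruct (Rdichotomy _ _ Hxy) as [Hlt|Hgt]; [now apply H|].
  assert (Hsym := H y x (1 - t) Hy Hx Hgt ltac:(lra)).
  replace (1 - (1 - t)) with t in Hsym by ring.
  rewrite (Rplus_comm (t * f x)), (Rplus_comm (t * x)); exact Hsym.
Qed.

(** Splitting [[x, y]] at [z = t * x + (1 - t) * y], the concavity gap
    [f z - (t * f x + (1 - t) * f y)] equals [t * (1 - t) * (y - x)] times the
    difference of the average slopes on the two pieces, and these slopes are
    values of [Derive f] at two ordered points. *)
Lemma strictly_concave_on_Derive_decr (f : R -> R) (p q : R) :
  (forall z, p < z < q -> ex_derive f z) ->
  (forall u v, p < u -> u < v -> v < q -> Derive f v < Derive f u) ->
  strictly_concave_on (fun z => p < z < q) f.
Proof.
  intros Hd Hdecr; apply strictly_concave_on_ordered.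
  intros x y t Hx Hy Hxy Ht.
  set (z := t * x + (1 - t) * y).
  assert (Hzx : z - x = (1 - t) * (y - x)) by (unfold z; ring).
  assert (Hyz : y - z = t * (y - x)) by (unfold z; ring).
  assert (0 < (1 - t) * (y - x)) by (apply Rmult_lt_0_compat; lra).
  assert (0 < t * (y - x)) by (apply Rmult_lt_0_compat; lra).
  destruct (mean_value_continuous_on f x z) as [u [Hu Hfu]].
  { lra. }
  { apply ex_derive_continuous_on; intros; apply Hd; lra. }
  { intros; apply Hd; lra. }
  destruct (mean_value_continuous_on f z y) as [v [Hv Hfv]].
  { lra. }
  { apply ex_derive_continuous_on; intros; apply Hd; lra. }
  { intros; apply Hd; lra. }
  assert (Huv : Derive f v < Derive f u) by (apply Hdecr; lra).
  rewrite Hzx in Hfu; rewrite Hyz in Hfv.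
  assert (Hgap : f z - (t * f x + (1 - t) * f y)
                 = t * ((1 - t) * (y - x)) * (Derive f u - Derive f v)).
  { transitivity (t * (f z - f x) - (1 - t) * (f y - f z)); [ring|].
    rewrite Hfu, Hfv; ring. }
  assert (0 < t * ((1 - t) * (y - x)) * (Derive f u - Derive f v)).
  { repeat apply Rmult_lt_0_compat; lra. }
  lra.
Qed.

Lemma strictly_concave_on_Derive2_neg (f : R -> R) (p q : R) :
  (forall z, p < z < q -> ex_derive f z) ->
  (forall z, p < z < q -> ex_derive (Derive f) z) ->
  (forall z, p < z < q -> Derive (Derive f) z < 0) ->
  strictly_concave_on (fun z => p < z < q) f.
Proof.
  intros Hd1 Hd2 Hneg; apply strictly_concave_on_Derive_decr; [exact Hd1|].
  intros u v Hpu Huv Hvq.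
  destruct (mean_value_continuous_on (Derive f) u v Huv) as [w [Hw Heq]].
  { apply ex_derive_continuous_on; intros; apply Hd2; lra. }
  { intros; apply Hd2; lra. }
  assert (Hw0 : Derive (Derive f) w < 0) by (apply Hneg; lra).
  assert (0 < - Derive (Derive f) w * (v - u)) by (apply Rmult_lt_0_compat; lra).
  lra.
Qed.

Lemma continuous_neg_interval (g : R -> R) (p q w : R) :
  p < w < q -> continuous g w -> g w < 0 ->
  exists p' q', p <= p' /\ p' < q' /\ q' <= q /\
    forall z, p' < z < q' -> g z < 0.
Proof.
  intros Hw Hc Hneg.
  destruct (Hc _ (open_lt 0 (g w) Hneg)) as [d Hd].
  exists (Rmax p (w - d)), (Rmin q (w + d)).
  assert (Hd0 := cond_pos d).
  repeat split.
  - apply Rmax_l.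
  - apply Rmax_lub_lt; apply Rmin_glb_lt; lra.
  - apply Rmin_l.
  - intros z [Hz1 Hz2]; apply Hd; change (Rabs (z - w) < d).
    assert (H1 := Rmax_r p (w - d)); assert (H2 := Rmin_r q (w + d)).
    apply Rabs_def1; lra.
Qed.

(** * From the relaxation ratio to a point of negative curvature *)

(** Below the chord through the origin, [1 / f y >= (c / f c) * / y]; the
    integral of the right-hand side is [(c / f c) * ln (c / eps)], and this lower
    bound for the crossing time is the claim after clearing denominators. *)
Lemma relaxation_ratio_ge1 (f : R -> R) (eps c : R) :
  0 < eps < c -> continuous_on (fun z => eps <= z <= c) f ->
  (forall y, eps <= y <= c -> 0 < f y) ->
  (forall y, eps < y < c -> f y <= f c / c * y) ->
  1 <= relaxation_ratio f eps c.
Proof.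
  intros Heps Hcont Hpos Hchord.
  assert (Hfc : 0 < f c) by (apply Hpos; lra).
  assert (HL : 0 < ln (c / eps)).
  { rewrite <- ln_1; apply ln_increasing; [lra|].
    apply Rmult_lt_reg_r with eps; [lra|]; field_simplify; lra. }
  assert (Hlow : is_RInt (fun y => c / f c * / y) eps c (c / f c * ln (c / eps))).
  { replace (c / f c * ln (c / eps))
      with (minus (c / f c * ln c) (c / f c * ln eps)).
    - apply (is_RInt_derive (fun y => c / f c * ln y)).
      + intros y; rewrite Rmin_left, Rmax_right by lra; intros Hy.
        auto_derive; [lra | field; lra].
      + intros y; rewrite Rmin_left, Rmax_right by lra; intros Hy.
        apply (ex_derive_continuous (fun y => c / f c * / y)).
        auto_derive; lra.
    - change (c / f c * ln c - c / f c * ln eps = c / f c * ln (c / eps)).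
      rewrite ln_div by lra; ring. }
  assert (Hint : ex_RInt (fun y => 1 / f y) eps c).
  { apply ex_RInt_ext with (fun y => / f (clamp eps c y)).
    - intros y; rewrite Rmin_left, Rmax_right by lra; intros Hy.
      rewrite clamp_id by lra; symmetry; apply Rmult_1_l.
    - apply (@ex_RInt_continuous R_CompleteNormedModule).
      intros y _; apply (continuous_comp (fun z => f (clamp eps c z)) Rinv).
      + apply continuous_clamp; [lra | exact Hcont].
      + apply continuous_Rinv, Rgt_not_eq, Hpos, clamp_bounds; lra. }
  assert (HT : c / f c * ln (c / eps) <= crossing_time f eps c).
  { rewrite <- (is_RInt_unique _ _ _ _ Hlow); unfold crossing_time.
    apply RInt_le; [lra | eexists; exact Hlow | exact Hint |].
    intros y Hy.
    replace (c / f c * / y) with (/ (f c / c * y)) by (field; lra).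
    unfold Rdiv at 2; rewrite Rmult_1_l.
    apply Rinv_le_contravar; [apply Hpos; lra | now apply Hchord]. }
  assert (Hc : 0 < c / f c) by (apply Rdiv_lt_0_compat; lra).
  assert (HT0 : 0 < crossing_time f eps c).
  { eapply Rlt_le_trans; [|exact HT]; now apply Rmult_lt_0_compat. }
  unfold relaxation_ratio, nominal_rate.
  replace (f c / (ln (c / eps) / crossing_time f eps c * c))
    with (crossing_time f eps c / (c / f c * ln (c / eps)))
    by (field; repeat split; lra).
  assert (HcL : 0 < c / f c * ln (c / eps)) by now apply Rmult_lt_0_compat.
  apply Rle_div_r; lra.
Qed.

(** A point above the chord is where the average slope to the left exceeds the
    average slope to the right; hence the derivative drops between two
    intermediate points. *)
Lemma above_chord_negative_Derive2 (f : R -> R) (c y : R) :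
  0 < y < c -> continuous_on (fun z => 0 <= z <= c) f -> f 0 = 0 ->
  (forall z, 0 < z < c -> ex_derive f z) ->
  (forall z, 0 < z < c -> ex_derive (Derive f) z) ->
  f c / c * y < f y ->
  exists w, 0 < w < c /\ Derive (Derive f) w < 0.
Proof.
  intros Hy Hcont Hf0 Hd1 Hd2 Habove.
  destruct (mean_value_continuous_on f 0 y) as [u [Hu Hfu]]; [lra | |
    intros; apply Hd1; lra |].
  { apply continuous_on_subset with (2 := Hcont); intros z Hz; lra. }
  destruct (mean_value_continuous_on f y c) as [v [Hv Hfv]]; [lra | |
    intros; apply Hd1; lra |].
  { apply continuous_on_subset with (2 := Hcont); intros z Hz; lra. }
  set (s := f c / c) in *.
  assert (Hs : f c = s * c) by (unfold s; field; lra).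
  (* The chord's slope [s] separates the two average slopes. *)
  assert (Hsu : s < Derive f u) by (apply Rmult_lt_reg_r with y; lra).
  assert (Hvs : Derive f v < s) by (apply Rmult_lt_reg_r with (c - y); lra).
  destruct (mean_value_continuous_on (Derive f) u v) as [w [Hw Hfw]]; [lra | | |].
  { apply ex_derive_continuous_on; intros; apply Hd2; lra. }
  { intros; apply Hd2; lra. }
  exists w; split; [lra|].
  apply Rmult_lt_reg_r with (v - u); lra.
Qed.

Theorem lemma3 (c : R) (a : Rbar) (alpha : R -> R)
    (hc : 0 < c)
    (hK : class_K a alpha)
    (hdom : forall x, 0 <= x <= c -> dom_K a x)
    (hcont : continuous_on (fun x => 0 <= x <= c) alpha)
    (hC2 : C_n_on 2 (fun x => 0 < x < c) alpha)
    (hr : exists eps, 0 < eps < c /\ relaxation_ratio alpha eps c < 1) :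
  exists I_cave : R -> Prop,
    nontrivial_interval I_cave /\
    (forall x, I_cave x -> 0 < x < c) /\
    strictly_concave_on I_cave alpha.
Proof.
  destruct hr as [eps [Heps Hr]].
  destruct hK as [_ [_ [_ [Hincr H0]]]].
  assert (Hd1 : forall z, 0 < z < c -> ex_derive alpha z).
  { intros z Hz; exact (proj1 (hC2 1%nat z ltac:(auto) Hz)). }
  assert (Hd2 : forall z, 0 < z < c -> ex_derive (Derive alpha) z).
  { intros z Hz; exact (proj1 (hC2 2%nat z ltac:(auto) Hz)). }
  assert (Habove : exists y, eps < y < c /\ alpha c / c * y < alpha y).
  { apply NNPP; intros Hno; apply (Rlt_not_le _ _ Hr).
    apply relaxation_ratio_ge1; [exact Heps | | |].
    - apply continuous_on_subset with (2 := hcont); intros z Hz; lra.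
    - intros y Hy; rewrite <- H0; apply Hincr; [apply hdom | apply hdom |]; lra.
    - intros y Hy; apply Rnot_lt_le; intros Hlt; apply Hno; now exists y. }
  destruct Habove as [y [Hy Hlt]].
  destruct (above_chord_negative_Derive2 alpha c y) as [w [Hw Hneg]];
    [lra | assumption .. |].
  destruct (continuous_neg_interval (Derive (Derive alpha)) 0 c w Hw)
    as [p [q [Hp [Hpq [Hq Hpqneg]]]]].
  { exact (proj2 (hC2 2%nat w ltac:(auto) Hw)). }
  { exact Hneg. }
  exists (fun z => p < z < q); split; [split|split].
  - intros x z t Hx Hz Ht; lra.
  - exists (p + (q - p) / 3), (p + 2 * (q - p) / 3); lra.
  - intros x Hx; lra.
  - apply strictly_concave_on_Derive2_neg; [| | exact Hpqneg];
      intros z Hz; [apply Hd1 | apply Hd2]; lra.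
Qed.
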